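(* In the computational model where an operator may only (a) read the stored real trajectory $\{R_t\}_{0\le t\le T}$, the observation stream, and derived metadata (provenance graph, checkpoints, environment snapshots), or (b) invoke $F$ to advance a state, any exact unlearning operator must invoke $F$ at least $T-\tau+1$ times in the worst case. The splicing operator (the selective-replay algorithm described in the context) invokes $F$ exactly $T-\tau+1$ times and is therefore optimal under the conservative taint model; the gain over a full reset ($T$ invocations) is $T/(T-\tau+1)$.
   Context: Runtime as a transition system. $\mathcal{R}$ is the set of runtime states (all reconstructible components of an LLM agent: KV cache, working memory, uncommitted tool plans) and $\mathcal{O}$ the set of external observations. A session of length $T$ with observation stream $o_1,\dots,o_T\in\mathcal{O}$ is the trajectory $R_t=F(R_{t-1},o_t;\theta)$, $t=1,\dots,T$, $R_0=R_{\mathrm{init}}$, where $F:\mathcal{R}\times\mathcal{O}\to\mathcal{R}$ is the deterministic transition map and $\theta$ the model parameters. The forget target $z$ first enters at step $\tau\ge 1$: $z\in o_\tau$ and $z\notin o_t$ for all $t<\tau$. Counterfactual trajectory. $o^{-z}_t=o_t$ for $t\neq\tau$ and $o^{-z}_\tau=o_\tau\setminus\{z\}$; $R^{-z}_0=R_{\mathrm{init}}$ and $R^{-z}_t=F(R^{-z}_{t-1},o^{-z}_t;\theta)$. Exact unlearning. With $\mathcal{Z}$ the set of possible forget targets, an unlearning operator $U:\mathcal{R}\times\mathcal{Z}\to\mathcal{R}$ is exact iff $U(R_T,z)=R^{-z}_T$ (deterministic decoding). The operator realizing $U$ works over the recorded runtime: observation log, provenance graph (a directed graph recording which artifacts produced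 during execution were derived from which), checkpoints, and environment snapshots. Splicing operator / selective-replay algorithm. Input: $R_T$, $z$, the provenance graph, a set of checkpoints, and the recorded observations. It locates the source artifact of $z$ in the provenance graph, its first entry step $\tau$, and the set of artifacts reachable from it; it chooses the latest checkpoint $c^*$ whose boundary is less than $\tau$ and restores the runtime state (and environment snapshot) there; then for $t=\mathrm{boundary}(c^* )+1,\dots,T$ it forms the sanitized observation $\tilde o_t$ ($o_t$ with $z$ removed and everything else kept, with tool observations reproduced by replay in a shadow environment) and sets $R\leftarrow F(R,\tilde o_t;\theta)$; it returns the final $R$. The corresponding replayed trajectory is $\tilde R_{\tau-1}=R_{\tau-1}$, $\tilde R_t=F(\tilde R_{t-1},\tilde o_t;\theta)$ for $t\ge\tau$. It is considered under the assumptions that decoding is deterministic (or the randomness source is fixed), that $\tilde o_t=o^{-z}_t$ for all $t\ge\tau$, and that no committed external side effects exist after $\tau$. Full reset. Recomputes the counterfactual trajectory from $R_{\mathrm{init}}$, using $T$ invocations of $F$. Conservative taint model. No per-token influence attribution is available (the map $F$ is not decomposed into selective reads of state components), so every artifact produced at step $\tau$ or later is treated as influenced by $z$.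
   Formalization: The lower bound and optimality assume at least (T+1)+(T-τ+1) runtime states (with a single state no call of F is needed); the splicing count, exactness, optimality and gain assume a checkpoint at boundary τ-1 (otherwise the replay is longer). *)

(* Defs.v *)
From mathcomp Require Import all_boot all_order all_algebra.
Set Implicit Arguments.
Unset Strict Implicit.
Unset Printing Implicit Defensive.

(* The parts of an agent runtime that do not depend on the transition map.
   [contains o z] is z \in o and [remove o z] is o \ {z}; [exec e c] runs the
   tool call [c] in (a shadow copy of) the environment [e]. *)
Record setting := Setting {
  state : Type;
  target : Type;
  observation : Type;
  contains : observation -> target -> bool;
  remove : observation -> target -> observation;
  env : Type;
  call : Type;
  exec : env -> call -> env * observation;
  contains_remove : forall o z, ~~ contains (remove o z) z;
  contains_remove_other : forall o z z',
    z' <> z -> contains (remove o z) z' = contains o z';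
  remove_absent : forall o z, ~~ contains o z -> remove o z = o }.

(* [derived a b]: artifact [b] was derived from artifact [a]. *)
Record provenance (Z : Type) := Provenance {
  artifact : finType;
  derived : rel artifact;
  produced : artifact -> nat;
  source : Z -> artifact }.

(* What is recorded about a session of length [horizon], besides the runtime
   states themselves.  Steps are numbered from 1 to [horizon]; values of [obs],
   [tool_call] and [committed] at other indices are junk.  A checkpoint is given
   by its boundary: the state it restores is the stored state at that step, and
   the environment it restores is the snapshot at that step. *)
Record runtime_log (S : setting) := RuntimeLog {
  horizon : nat;
  obs : nat -> observation S;
  tool_call : nat -> option (call S);
  committed : nat -> bool;
  prov : provenance (target S);
  checkpoints : seq nat;
  snapshot : nat -> env S }.

(* The parameters theta are fixed during a session: a transition map stands for
   F( . , . ; theta). *)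
Definition transition (S : setting) := state S -> observation S -> state S.

Fixpoint trajectory (S : setting) (F : transition S) (Rinit : state S)
    (o : nat -> observation S) (t : nat) : state S :=
  if t is t'.+1 then F (trajectory F Rinit o t') (o t) else Rinit.

Definition first_entry (S : setting) (L : runtime_log S) (z : target S)
    (tau : nat) : Prop :=
  [/\ 0 < tau <= horizon L,
      contains (obs L tau) z
    & forall t, 0 < t < tau -> ~~ contains (obs L t) z].

Definition cf_obs (S : setting) (L : runtime_log S) (z : target S)
    (tau t : nat) : observation S :=
  if t == tau then remove (obs L t) z else obs L t.

Definition cf_state (S : setting) (F : transition S) (Rinit : state S)
    (L : runtime_log S) (z : target S) (tau : nat) : state S :=
  trajectory F Rinit (cf_obs L z tau) (horizon L).

Definition stored (S : setting) (F : transition S) (Rinit : state S)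
    (L : runtime_log S) : 'I_(horizon L).+1 -> state S :=
  fun t => trajectory F Rinit (obs L) t.
Arguments stored {S} F Rinit L _.

(* Computations with oracle access to the transition map.  Only [Invoke] calls
   it; the continuation receives the resulting state. *)
Inductive prog (S : setting) : Type :=
  | Done of state S
  | Invoke of state S & observation S & (state S -> prog S).

Fixpoint result (S : setting) (F : transition S) (p : prog S) : state S :=
  match p with
  | Done r => r
  | Invoke r o k => result F (k (F r o))
  end.

Fixpoint invocations (S : setting) (F : transition S) (p : prog S) : nat :=
  match p with
  | Done _ => 0
  | Invoke r o k => (invocations F (k (F r o))).+1
  end.

(* A state may be advanced or returned only if it has been read or has been
   obtained from an earlier invocation. *)
Fixpoint legal (S : setting) (avail : state S -> Prop) (p : prog S) : Prop :=
  match p with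
  | Done r => avail r
  | Invoke r o k =>
      avail r /\ forall r', legal (fun x => avail x \/ x = r') (k r')
  end.

(* An operator reads the log, the stored real trajectory and the target for
   free; it does not see the transition map except through [Invoke]. *)
Definition operator (S : setting) : Type :=
  forall L : runtime_log S,
    ('I_(horizon L).+1 -> state S) -> target S -> prog S.

Definition confined (S : setting) (U : operator S) : Prop :=
  forall (L : runtime_log S) (R : 'I_(horizon L).+1 -> state S) (z : target S),
    legal (fun x => exists t, x = R t) (U L R z).

Definition unlearn (S : setting) (U : operator S) (F : transition S)
    (Rinit : state S) (L : runtime_log S) (z : target S) : state S :=
  result F (U L (stored F Rinit L) z).

Definition calls (S : setting) (U : operator S) (F : transition S)
    (Rinit : state S) (L : runtime_log S) (z : target S) : nat :=
  invocations F (U L (stored F Rinit L) z).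

(* Exactness on the sessions with log [L], whatever the transition map and the
   initial state are. *)
Definition exact_unlearning (S : setting) (U : operator S)
    (L : runtime_log S) (z : target S) (tau : nat) : Prop :=
  forall (F : transition S) (Rinit : state S),
    unlearn U F Rinit L z = cf_state F Rinit L z tau.

Definition worst_case_ge (S : setting) (U : operator S) (L : runtime_log S)
    (z : target S) (n : nat) : Prop :=
  exists (F : transition S) (Rinit : state S), n <= calls U F Rinit L z.

(* The last clause says that the worst-case number of invocations of [U] is at
   most that of any competitor [V]. *)
Definition optimal (S : setting) (U : operator S) (L : runtime_log S)
    (z : target S) (tau : nat) : Prop :=
  [/\ confined U, exact_unlearning U L z tau
    & forall V : operator S, confined V -> exact_unlearning V L z tau ->
      forall n, worst_case_ge U L z n -> worst_case_ge V L z n].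

(* There are at least as many states as in R_0, ..., R_T together with
   R^{-z}_tau, ..., R^{-z}_T, so that these may be pairwise distinct.  Some such
   condition is needed: over a one-point state space nothing has to be
   recomputed. *)
Definition enough_states (S : setting) (T tau : nat) : Prop :=
  exists f : 'I_(T.+1 + (T - tau).+1) -> state S, injective f.

Definition source_artifact (S : setting) (L : runtime_log S) (z : target S) :
    artifact (prov L) := source (prov L) z.

Definition entry_step (S : setting) (L : runtime_log S) (z : target S) : nat :=
  produced (source_artifact L z).

Definition influenced (S : setting) (L : runtime_log S) (z : target S) :
    {set artifact (prov L)} :=
  [set a | connect (@derived _ (prov L)) (source_artifact L z) a].

Definition conservative_taint (S : setting) (L : runtime_log S) (z : target S)
    (tau : nat) : Prop :=
  influenced L z = [set a | tau <= produced a].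

(* Boundary of the latest checkpoint before the entry of z; when there is none
   it is 0, i.e. R_init. *)
Definition restore_point (S : setting) (L : runtime_log S) (z : target S) :
    nat :=
  \max_(b <- checkpoints L | b < entry_step L z) b.

(* The shadow environment restored at boundary [b], after replaying the tool
   calls of steps b+1, ..., b+n. *)
Fixpoint shadow_env (S : setting) (L : runtime_log S) (b n : nat) : env S :=
  if n is n'.+1 then
    if tool_call L (b + n) is Some c then (exec (shadow_env L b n') c).1
    else shadow_env L b n'
  else snapshot L b.

Definition reproduced (S : setting) (L : runtime_log S) (b t : nat) :
    observation S :=
  if tool_call L t is Some c then (exec (shadow_env L b (t - b).-1) c).2
  else obs L t.

Definition sanitized (S : setting) (L : runtime_log S) (z : target S)
    (t : nat) : observation S :=
  remove (reproduced L (restore_point L z) t) z.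

Fixpoint advance (S : setting) (r : state S) (os : seq (observation S)) :
    prog S :=
  if os is o :: os' then Invoke r o (fun r' => advance r' os') else Done r.

Definition splice (S : setting) : operator S := fun L R z =>
  let b := restore_point L z in
  advance (R (inord b)) [seq sanitized L z t | t <- iota b.+1 (horizon L - b)].

Definition full_reset (S : setting) : operator S := fun L R z =>
  advance (R ord0)
    [seq cf_obs L z (entry_step L z) t | t <- iota 1 (horizon L)].

(* The checkpoint clause reflects that the whole real trajectory is stored, so
   that replay can start from R_{tau-1}. *)
Record replay_assumptions (S : setting) (L : runtime_log S) (z : target S)
    (tau : nat) : Prop := ReplayAssumptions {
  source_located : entry_step L z = tau;
  last_clean_state_checkpointed : tau.-1 \in checkpoints L;
  sanitized_cf : forall t, tau <= t <= horizon L ->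
    sanitized L z t = cf_obs L z tau t;
  no_committed_effects : forall t, tau < t <= horizon L -> ~~ committed L t }.

(* Ratio of the numbers of invocations of [U] and of [V] on a session. *)
Definition gain (S : setting) (U V : operator S) (F : transition S)
    (Rinit : state S) (L : runtime_log S) (z : target S) : rat :=
  ((calls U F Rinit L z)%:R / (calls V F Rinit L z)%:R)%R.

(* Main.v *)
Require Import Defs.
From mathcomp Require Import all_boot all_order all_algebra.
From mathcomp Require Import boolp zify.

(** Lower bound: let F move along a chain of distinct states, the real states
    R_0, ..., R_T in positions 0, ..., T followed by the counterfactual states
    R'_tau, ..., R'_T in positions T+1, ..., 2T-tau+1, except that reading a
    z-free observation in R_{tau-1} leads to R'_tau.  The free states are those
    in positions at most T, and one invocation increases the largest available
    position by at most one, whereas the answer R'_T is in the last position. *)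

Lemma trajectory_eq (S : setting) (F : transition S) (Rinit : state S)
    (o o' : nat -> observation S) (n : nat) :
  (forall t, 0 < t <= n -> o t = o' t) ->
  trajectory F Rinit o n = trajectory F Rinit o' n.
Proof.
elim: n => //= n IHn eq_o.
by rewrite eq_o ?leqnn // IHn // => t /andP[t_gt0 /leqW t_le]; rewrite eq_o ?t_gt0.
Qed.

Lemma legal_advance (S : setting) (avail : state S -> Prop) (r : state S)
    (os : seq (observation S)) :
  avail r -> legal avail (advance r os).
Proof.
elim: os avail r => //= o os IHos avail r avail_r; split=> // r'.
by apply: IHos; right.
Qed.

Lemma invocations_advance (S : setting) (F : transition S) (r : state S)
    (os : seq (observation S)) :
  invocations F (advance r os) = size os.
Proof. by elim: os r => //= o os IHos r; rewrite IHos. Qed.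

(** The starting step [b] is arbitrary so that this serves both splicing ([b = tau.-1]) and the full
    reset ([b = 0]). *)
Lemma result_advance_trajectory (S : setting) (F : transition S)
    (Rinit : state S) (o : nat -> observation S) (b n : nat) :
  result F (advance (trajectory F Rinit o b) [seq o t | t <- iota b.+1 n])
    = trajectory F Rinit o (b + n).
Proof.
elim: n b => [|n IHn] b /=; first by rewrite addn0.
by rewrite -addSnnS -IHn.
Qed.

Lemma splice_confined (S : setting) : confined (@splice S).
Proof. by move=> L R z; apply: legal_advance; eexists. Qed.

Lemma full_reset_confined (S : setting) : confined (@full_reset S).
Proof. by move=> L R z; apply: legal_advance; eexists. Qed.

(** Potential argument: each invocation adds one available state and raises the index by one, and
    monotonicity of [P] carries the older states along. *)
Lemma legal_result_rank {S : setting} {F : transition S}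
    {P : nat -> state S -> Prop} {avail : state S -> Prop} {p : prog S}
    {k : nat} :
  (forall j x, P j x -> P j.+1 x) ->
  (forall j x o, P j x -> P j.+1 (F x o)) ->
  (forall x, avail x -> P k x) -> legal avail p ->
  P (k + invocations F p) (result F p).
Proof.
move=> P_mono P_step; elim: p avail k => [r|r o c IHp] avail k P_avail /=.
  by rewrite addn0 => /P_avail.
case=> avail_r /(_ (F r o)) legal_c; rewrite -addSnnS.
apply: IHp legal_c => x [/P_avail/P_mono //|->].
exact/P_step/P_avail.
Qed.

Lemma leq_inord (n m : nat) : (inord m : 'I_n.+1) <= m.
Proof. by rewrite /inord val_insubd; case: ifP. Qed.

(* Overflowing positions are sent to 0 by [inord], which preserves the bound of
   [chain_rank_le_step]. *)
Definition chain_next {S : setting} (z : target S) (T tau : nat)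
    (o : observation S) (i : nat) : nat :=
  if (i == tau.-1) && ~~ contains o z then T.+1 else i.+1.

(** Equality on [state S] is not decidable, so the position of [x] is found classically; states off
    the chain are fixed points. *)
Definition chain_transition {S : setting} {n : nat} (f : 'I_n.+1 -> state S)
    (z : target S) (T tau : nat) : transition S := fun x o =>
  if [pick i | `[< x = f i >]] is Some i then f (inord (chain_next z T tau o i))
  else x.

Definition chain_rank_le {S : setting} {n : nat} (f : 'I_n.+1 -> state S)
    (m : nat) (x : state S) : Prop :=
  exists2 i : 'I_n.+1, i <= m & x = f i.

Lemma chain_transitionE (S : setting) (n : nat) (f : 'I_n.+1 -> state S)
    (z : target S) (T tau : nat) (i : 'I_n.+1) (o : observation S) :
  injective f ->
  chain_transition f z T tau (f i) o = f (inord (chain_next z T tau o i)).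
Proof.
move=> f_inj; rewrite /chain_transition.
by case: pickP => [j /asboolP/f_inj <- //|/(_ i)]; rewrite asboolT.
Qed.

(** The jump lands at [T.+1], which is within [m.+1] precisely because [T <= m]. *)
Lemma chain_rank_le_step (S : setting) (n : nat) (f : 'I_n.+1 -> state S)
    (z : target S) (T tau m : nat) (x : state S) (o : observation S) :
  injective f -> T <= m -> chain_rank_le f m x ->
  chain_rank_le f m.+1 (chain_transition f z T tau x o).
Proof.
move=> f_inj T_le [i i_le ->]; rewrite chain_transitionE //.
exists (inord (chain_next z T tau o i)) => //; apply: leq_trans (leq_inord _ _) _.
by rewrite /chain_next; case: ifP.
Qed.

(** The only possible jump is at position [tau.-1], where [o tau] is read. Requiring z there only if
    [tau <= t] also covers the counterfactual prefix. *)
Lemma chain_trajectory (S : setting) (n : nat) (f : 'I_n.+1 -> state S)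
    (z : target S) (T tau : nat) (o : nat -> observation S) (t : nat) :
  injective f -> 0 < tau -> t <= n -> (tau <= t -> contains (o tau) z) ->
  trajectory (chain_transition f z T tau) (f ord0) o t = f (inord t).
Proof.
move=> f_inj tau_gt0; elim: t => [|t IHt] t_le z_in /=.
  by congr f; apply/val_inj; rewrite /= inordK.
rewrite IHt ?(ltnW t_le) // => [|tau_le]; last exact/z_in/leqW.
rewrite chain_transitionE // /chain_next inordK; last exact: leqW.
case: eqP => //= t_eq; move: z_in; rewrite t_eq prednK // => -> //.
Qed.

(** Step [tau] takes the jump; afterwards all positions exceed [T >= tau], so it cannot recur. *)
Lemma chain_counterfactual (S : setting) (n : nat) (f : 'I_n.+1 -> state S)
    (z : target S) (T tau : nat) (o : nat -> observation S) (d : nat) :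
  injective f -> 0 < tau <= T -> T.+1 + d <= n -> ~~ contains (o tau) z ->
  trajectory (chain_transition f z T tau) (f ord0) o (tau + d)
    = f (inord (T.+1 + d)).
Proof.
move=> f_inj /andP[tau_gt0 tau_le] d_le z_notin; elim: d d_le => [|d IHd] d_le.
  rewrite !addn0 -{2}(prednK tau_gt0) /= chain_trajectory //; try lia.
  rewrite chain_transitionE // /chain_next inordK; last lia.
  by rewrite eqxx prednK // z_notin.
rewrite addnS /= IHd; last lia.
rewrite chain_transitionE // /chain_next inordK; last lia.
by rewrite addnS; case: eqP => //=; lia.
Qed.

Lemma calls_lower_bound (S : setting) (L : runtime_log S) (z : target S)
    (tau : nat) (U : operator S) :
  first_entry L z tau -> confined U -> exact_unlearning U L z tau ->
  enough_states S (horizon L) tau ->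
  exists (F : transition S) (Rinit : state S),
    horizon L - tau + 1 <= calls U F Rinit L z.
Proof.
move=> [tau_bnd z_in _] U_conf U_exact; set T := horizon L => -[f0 f0_inj].
have [n nE [f f_inj]] : exists2 n, n = T + (T - tau).+1
    & exists f : 'I_n.+1 -> state S, injective f.
  by exists (T + (T - tau).+1); last exists f0.
have /andP[tau_gt0 tau_le] := tau_bnd.
exists (chain_transition f z T tau), (f ord0); rewrite /calls.
set F := chain_transition f z T tau.
have := U_exact F (f ord0); rewrite /unlearn /cf_state.
(* With [d = T - tau] the required answer sits at [T.+1 + (T - tau) = n], the end of the chain. *)
rewrite -[horizon L](subnKC tau_le) chain_counterfactual //; first last.
- by rewrite /cf_obs eqxx contains_remove.
- by rewrite nE addSnnS.
set p := U _ _ _ => resE.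
have := @legal_result_rank S F (fun k => chain_rank_le f (T + k)) _ p 0.
case/(_ _ _ _ _ (U_conf _ _ _)).
- by move=> j x [i i_le ->]; exists i; rewrite // addnS leqW.
- by move=> j x o xP; rewrite addnS; apply: chain_rank_le_step; rewrite ?leq_addr.
- move=> x [t ->]; exists (inord t).
    by rewrite addn0 (leq_trans (leq_inord _ _)) // -ltnS.
  rewrite /stored chain_trajectory //; have := ltn_ord t; rewrite -/T; lia.
(* By injectivity, the answer's position [T.+1 + (T - tau)] is at most [T] plus the number of
   calls. *)
move=> i i_le; rewrite resE => /f_inj def_i; move: i_le.
by rewrite -def_i inordK; lia.
Qed.

(** Boundaries below [tau] are at most [tau.-1], and that bound is attained by a checkpoint. *)
Lemma restore_pointE (S : setting) (L : runtime_log S) (z : target S)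
    (tau : nat) :
  0 < tau -> replay_assumptions L z tau -> restore_point L z = tau.-1.
Proof.
move=> tau_gt0 [entryE tau_in _ _]; rewrite /restore_point entryE.
apply/eqP; rewrite eqn_leq; apply/andP; split.
  by apply/bigmax_leqP_seq => b _; lia.
by apply: (leq_bigmax_seq (F := id)) => //; lia.
Qed.

Lemma splice_calls (S : setting) (F : transition S) (Rinit : state S)
    (L : runtime_log S) (z : target S) (tau : nat) :
  0 < tau <= horizon L -> replay_assumptions L z tau ->
  calls (@splice S) F Rinit L z = horizon L - tau + 1.
Proof.
move=> /andP[tau_gt0 tau_le] replayP.
rewrite /calls /splice (restore_pointE _ _ _ _ tau_gt0 replayP).
by rewrite invocations_advance size_map size_iota; lia.
Qed.

Lemma splice_exact (S : setting) (L : runtime_log S) (z : target S)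
    (tau : nat) :
  0 < tau <= horizon L -> replay_assumptions L z tau ->
  exact_unlearning (@splice S) L z tau.
Proof.
move=> /andP[tau_gt0 tau_le] replayP F Rinit.
rewrite /unlearn /splice (restore_pointE _ _ _ _ tau_gt0 replayP).
have/eq_in_map-> : {in iota tau.-1.+1 (horizon L - tau.-1),
    sanitized L z =1 cf_obs L z tau}.
  move=> t; rewrite mem_iota => t_bnd.
  by rewrite (sanitized_cf replayP) //; lia.
rewrite /stored inordK; last lia.
(* The two observation streams agree before [tau], so the restored state already lies on the
   counterfactual trajectory. *)
rewrite (trajectory_eq _ _ _ _ (cf_obs L z tau)); last first.
  by move=> t t_bnd; rewrite /cf_obs; case: eqP => //; lia.
by rewrite result_advance_trajectory subnKC //; lia.
Qed.

Lemma full_reset_calls (S : setting) (F : transition S) (Rinit : state S)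
    (L : runtime_log S) (z : target S) :
  calls (@full_reset S) F Rinit L z = horizon L.
Proof.
by rewrite /calls /full_reset invocations_advance size_map size_iota.
Qed.

Lemma full_reset_exact (S : setting) (L : runtime_log S) (z : target S) :
  exact_unlearning (@full_reset S) L z (entry_step L z).
Proof.
by move=> F Rinit; apply: (result_advance_trajectory _ F Rinit _ 0).
Qed.

Theorem corollary1 (S : setting) (L : runtime_log S) (z : target S) (tau : nat)
    (T := horizon L) (z_entry : first_entry L z tau) :
  (forall U : operator S, confined U -> exact_unlearning U L z tau ->
     enough_states S T tau ->
     exists (F : transition S) (Rinit : state S),
       T - tau + 1 <= calls U F Rinit L z)
  /\
  (replay_assumptions L z tau ->
   [/\ confined (@splice S) /\ exact_unlearning (@splice S) L z tau,
       (forall (F : transition S) (Rinit : state S),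
          calls (@splice S) F Rinit L z = T - tau + 1),
       (conservative_taint L z tau -> enough_states S T tau ->
          optimal (@splice S) L z tau),
       confined (@full_reset S) /\ exact_unlearning (@full_reset S) L z tau
     & forall (F : transition S) (Rinit : state S),
         calls (@full_reset S) F Rinit L z = T /\
         gain (@full_reset S) (@splice S) F Rinit L z
           = (T%:R / (T - tau + 1)%:R)%R]).
Proof.
have [tau_bnd _ _] := z_entry; rewrite /T.
split=> [U|replayP]; first exact: calls_lower_bound.
have callsE F Rinit := splice_calls _ F Rinit _ _ _ tau_bnd replayP.
have splice_ex := splice_exact _ _ _ _ tau_bnd replayP.
split=> // [|_ enough||F Rinit].
- by split=> //; apply: splice_confined.
- split=> // [|V V_conf V_exact k [F [Rinit]]]; first exact: splice_confined.
  (* Splicing has the same cost on every session, so [k] is at most [T - tau + 1], which the lower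
     bound forces on [V] for some transition map. *)
  rewrite callsE => k_le.
  have [F' [Rinit' V_ge]] :=
    calls_lower_bound _ _ _ _ _ z_entry V_conf V_exact enough.
  by exists F', Rinit'; apply: leq_trans V_ge.
- split; first exact: full_reset_confined.
  by rewrite -(source_located replayP); apply: full_reset_exact.
- by rewrite /gain callsE full_reset_calls.
Qed.
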